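(* Let $H \leq \mathrm{GL}(d,\mathbb{R})$ be a connectivity-respecting integrably admissible dilation group with essential frequency support $\mathcal{O}$. Let $C \subseteq \mathcal{O}$ be compact and connected with $\mathcal{O} = H^T C$, let $\mathcal{O}_0$ be the connected component of $\mathcal{O}$ containing $C$, let $H_0 = \{h \in H : h^T\mathcal{O}_0 = \mathcal{O}_0\}$, and let $W \subseteq H_0$ be a nonempty, open, precompact, symmetric generating set for $H_0$. Let $\mathcal{Q} = (h_i^{-T}Q)_{i\in I}$ be an induced cover of $\mathcal{O}$, where $Q\subseteq\mathcal{O}$ is open, bounded and connected with $C \subseteq Q$ and $\overline{Q}\subseteq\mathcal{O}$, and $(h_i)_{i \in I}$ is well-spread in $H$. Let $d_C$ be a bounded metric on $C$ and equip $H \times C$ with $d_{H\times C}((h,\xi),(g,\eta)) := d_W(h,g) + d_C(\xi,\eta)$. Then the full orbit map $$p : (H \times C, d_{H\times C}) \to (\mathcal{O}, d_{\mathcal{Q}}), \quad (h,\xi) \mapsto h^{-T}\xi,$$ is a surjective quasi-isometry.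
   Context: Notation: $h^{-T} := (h^{-1})^T$ and $H^T C := \{h^T\xi : h\in H, \xi\in C\}$. Integrably admissible: a closed subgroup $H \leq \mathrm{GL}(d,\mathbb{R})$ is integrably admissible if there is a (necessarily unique) set $\mathcal{O}\subseteq\mathbb{R}^d$, called its essential frequency support, such that (a1) $\mathcal{O}$ is open with complement a Lebesgue null-set; (a2) $\mathcal{O} = H^T C$ for some compact $C\subseteq\mathcal{O}$; (a3) for each compact $K\subseteq\mathcal{O}$ the set $\{(h,\xi)\in H\times\mathcal{O} : (h^T\xi,\xi)\in K\times K\}$ is compact. Connectivity-respecting: an integrably admissible $H$ is connectivity-respecting if there is a compact, connected set $C \subseteq\mathcal{O}$ with $\mathcal{O} = H^TC$, and the stabilizer $H_0 = \{h\in H : h^T\mathcal{O}_0 = \mathcal{O}_0\}$ of the connected component $\mathcal{O}_0$ of $\mathcal{O}$ containing $C$ is compactly generated. Word metric: $d_W(x,y) = \inf\{m\in\mathbb{N} : x^{-1}y\in W^m\}$ for $x\neq y$ in $H$, and $d_W(x,x)=0$, with $\inf\emptyset = \infty$. Well-spread: a family $(h_i)_{i\in I}$ in $H$ is uniformly discrete if there is an open set $U \subseteq H$ containing the identity with $h_iU\cap h_jU=\emptyset$ for $i\ne j$; it is uniformly dense if $H = \bigcup_i h_iV$ for some relatively compact $V\subseteq H$; it is well-spread if it is a finite union of uniformly discrete families and uniformly dense. Induced cover: a family $\mathcal{Q}=(h_i^{-T}Q)_{i\in I}$ with $Q$ and $(h_i)$ as in the claim, for which there is an open set $P$ with $\overline{P}\subseteq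 Q$ such that $\mathcal{O}=\bigcup_i h_i^{-T}P = \bigcup_i h_i^{-T}Q$, $\sup_i \#\{j : h_i^{-T}Q\cap h_j^{-T}Q\neq\emptyset\}<\infty$, and $\sup\{\|h_i^{T}h_j^{-T}\| : h_i^{-T}Q\cap h_j^{-T}Q\ne\emptyset\}<\infty$. Chain distance: for a cover $\mathcal{Q}=(Q_i)_{i\in I}$ of $\mathcal{O}$, a $\mathcal{Q}$-chain of length $m$ from $x$ to $y$ is a sequence $Q_{i_1},\dots,Q_{i_m}$ with $x\in Q_{i_1}$, $y\in Q_{i_m}$ and $Q_{i_k}\cap Q_{i_{k+1}}\neq\emptyset$ for $1\le k\le m-1$. Then $d_{\mathcal{Q}}(x,y)$ is the infimum of the lengths of $\mathcal{Q}$-chains from $x$ to $y$ if $x\ne y$ ($\infty$ if there are none), and $d_{\mathcal{Q}}(x,x)=0$. Quasi-isometry: metrics may take the value $\infty$, and inequalities are understood in $[0,\infty]$. A map $f:(X,d_X)\to(Y,d_Y)$ is a quasi-isometry if there are $R_1,R_2,R_3>0$ with $R_1^{-1}d_X(x,x')-R_2\le d_Y(f(x),f(x'))\le R_1d_X(x,x')+R_2$ for all $x,x'\in X$, and for every $y\in Y$ there is $x\in X$ with $d_Y(f(x),y)\le R_3$. *)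

(* Defs.v *)
From mathcomp Require Import all_boot all_order all_algebra.
From mathcomp Require Import all_classical all_reals all_analysis.

Set Implicit Arguments.
Unset Strict Implicit.
Unset Printing Implicit Defensive.

Import Order.TTheory GRing.Theory Num.Theory.
Import numFieldNormedType.Exports.

Local Open Scope classical_set_scope.
Local Open Scope ring_scope.

(* Subsets of GL(d, R) and of R^d are sets of square matrices and of column
   vectors.  A topological notion relative to a subset X is expressed through
   the ambient space: the open (closed) sets of X are the traces on X of the
   ambient ones, the closure of A in X is X `&` closure A, and compactness of a
   subset does not depend on the surrounding space. *)

Definition GL (R : realType) (d : nat) : set 'M[R]_d :=
  [set h | h \in unitmx].
Arguments GL : clear implicits.

Definition open_in (T : topologicalType) (X A : set T) : Prop :=
  exists2 V : set T, open V & A = X `&` V.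

Definition closed_in (T : topologicalType) (X A : set T) : Prop :=
  exists2 V : set T, closed V & A = X `&` V.

Definition relatively_compact_in (T : topologicalType) (X A : set T) : Prop :=
  A `<=` X /\ compact (X `&` closure A).

Definition is_subgroup (R : realType) (d : nat) (H : set 'M[R]_d) : Prop :=
  [/\ H `<=` GL R d,
      H 1%:M,
      (forall g h, H g -> H h -> H (g *m h)) &
      (forall h, H h -> H (invmx h))].

Definition generates (R : realType) (d : nat) (H A : set 'M[R]_d) : Prop :=
  A `<=` H /\ smallest (@is_subgroup R d) A = H.

Definition compactly_generated (R : realType) (d : nat) (H : set 'M[R]_d) :
    Prop :=
  exists2 K : set 'M[R]_d, compact K & generates H K.

(* h^T xi, and the action h^{-T} xi *)
Definition tact (R : realType) (d : nat) (h : 'M[R]_d) (xi : 'cV[R]_d) :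
  'cV[R]_d := h^T *m xi.

Definition dual_act (R : realType) (d : nat) (h : 'M[R]_d) (xi : 'cV[R]_d) :
  'cV[R]_d := (invmx h)^T *m xi.

(* H^T C *)
Definition tact_set (R : realType) (d : nat) (H : set 'M[R]_d)
  (C : set 'cV[R]_d) : set 'cV[R]_d := [set tact h xi | h in H & xi in C].

Definition box (R : realType) (d : nat) (a b : 'cV[R]_d) : set 'cV[R]_d :=
  [set x | forall i, a i ord0 <= x i ord0 <= b i ord0].

(* The library has Lebesgue measure on the line only; this is vanishing of the
   d-dimensional Lebesgue outer measure. *)
Definition lebesgue_null (R : realType) (d : nat) (A : set 'cV[R]_d) : Prop :=
  forall e : R, 0 < e ->
  exists (D : set nat) (a b : nat -> 'cV[R]_d),
    [/\ (forall k i, a k i ord0 <= b k i ord0),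
        A `<=` \bigcup_(k in D) box (a k) (b k) &
        (\esum_(k in D) (\prod_(i < d) (b k i ord0 - a k i ord0))%:E
          <= e%:E)%E].

(* H is integrably admissible with essential frequency support O *)
Definition integrably_admissible (R : realType) (d : nat) (H : set 'M[R]_d)
    (O : set 'cV[R]_d) : Prop :=
  [/\ is_subgroup H /\ closed_in (GL R d) H,
      open O /\ lebesgue_null (~` O),
      (exists C : set 'cV[R]_d, [/\ C `<=` O, compact C & O = tact_set H C]) &
      (forall K : set 'cV[R]_d, K `<=` O -> compact K ->
         compact [set z : 'M[R]_d * 'cV[R]_d |
           [/\ H z.1, O z.2, K (tact z.1 z.2) & K z.2]])].

Definition component_containing (T : topologicalType) (X C X0 : set T) : Prop :=
  (exists2 x, X x & X0 = connected_component X x) /\ C `<=` X0.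

Definition stabilizer (R : realType) (d : nat) (H : set 'M[R]_d)
  (O0 : set 'cV[R]_d) : set 'M[R]_d := [set h | H h /\ tact h @` O0 = O0].

Definition connectivity_respecting (R : realType) (d : nat) (H : set 'M[R]_d)
    (O : set 'cV[R]_d) : Prop :=
  integrably_admissible H O /\
  exists C O0 : set 'cV[R]_d,
    [/\ C `<=` O, compact C /\ connected C, O = tact_set H C,
        component_containing O C O0 &
        compactly_generated (stabilizer H O0)].

Fixpoint set_pow (R : realType) (d : nat) (W : set 'M[R]_d) (m : nat) :
    set 'M[R]_d :=
  if m is n.+1 then [set w *m v | w in W & v in set_pow W n] else [set 1%:M].

Definition word_dist (R : realType) (d : nat) (W : set 'M[R]_d)
    (x y : 'M[R]_d) : \bar R :=
  if x == y then 0%E else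
  ereal_inf [set m%:R%:E | m in [set m : nat | set_pow W m (invmx x *m y)]].

(* The subfamily of (h_i) indexed by J is uniformly discrete in H. *)
Definition uniformly_discrete (R : realType) (d : nat) (H : set 'M[R]_d)
    (I : Type) (h : I -> 'M[R]_d) (J : set I) : Prop :=
  exists U : set 'M[R]_d, [/\ open_in H U, U 1%:M &
    forall i j, J i -> J j -> i <> j ->
      (mulmx (h i) @` U) `&` (mulmx (h j) @` U) = set0].

Definition uniformly_dense (R : realType) (d : nat) (H : set 'M[R]_d)
    (I : Type) (h : I -> 'M[R]_d) : Prop :=
  exists2 V : set 'M[R]_d, relatively_compact_in H V &
    H = \bigcup_i (mulmx (h i) @` V).

Definition well_spread (R : realType) (d : nat) (H : set 'M[R]_d)
    (I : Type) (h : I -> 'M[R]_d) : Prop :=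
  [/\ (forall i, H (h i)),
      (exists (n : nat) (J : 'I_n -> set I),
         \bigcup_k J k = [set: I] /\
         forall k, uniformly_discrete H h (J k)) &
      uniformly_dense H h].

Definition translates (R : realType) (d : nat) (I : Type) (h : I -> 'M[R]_d)
  (Q : set 'cV[R]_d) (i : I) : set 'cV[R]_d := dual_act (h i) @` Q.

(* The norm is the entrywise maximum norm of the library; finiteness of the
   supremum does not depend on the choice of the matrix norm. *)
Definition induced_cover (R : realType) (d : nat) (O : set 'cV[R]_d)
    (I : Type) (h : I -> 'M[R]_d) (Q : set 'cV[R]_d) : Prop :=
  exists P : set 'cV[R]_d,
    [/\ open P /\ closure P `<=` Q,
        O = \bigcup_i translates h P i,
        O = \bigcup_i translates h Q i,
        (exists N : nat, forall i,
           ([set j | translates h Q i `&` translates h Q j !=set0]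
              #<= `I_N)%card) &
        (exists M : R, forall i j,
           translates h Q i `&` translates h Q j !=set0 ->
           `|(h i)^T *m (invmx (h j))^T| <= M)].

(* The chain is Qs (c 0), ..., Qs (c (m - 1)); later values of c are unused. *)
Definition is_chain (T I : Type) (Qs : I -> set T) (x y : T) (m : nat) : Prop :=
  exists c : nat -> I,
    [/\ (0 < m)%N, Qs (c 0%N) x, Qs (c m.-1) y &
        forall k, (k.+1 < m)%N -> Qs (c k) `&` Qs (c k.+1) !=set0].

Definition chain_dist (R : realType) (T : eqType) (I : Type) (Qs : I -> set T)
    (x y : T) : \bar R :=
  if x == y then 0%E else
  ereal_inf [set m%:R%:E | m in [set m : nat | is_chain Qs x y m]].

Definition is_bounded_metric (R : realType) (T : Type) (X : set T)
    (dX : T -> T -> R) : Prop :=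
  [/\ (forall x y, X x -> X y -> 0 <= dX x y /\ (dX x y = 0 <-> x = y)),
      (forall x y, X x -> X y -> dX x y = dX y x),
      (forall x y z, X x -> X y -> X z -> dX x z <= dX x y + dX y z) &
      (exists M : R, forall x y, X x -> X y -> dX x y <= M)].

Definition quasi_isometry (R : realType) (T1 T2 : Type)
    (X : set T1) (dX : T1 -> T1 -> \bar R)
    (Y : set T2) (dY : T2 -> T2 -> \bar R) (f : T1 -> T2) : Prop :=
  set_fun X Y f /\
  exists R1 R2 R3 : R, [/\ 0 < R1 /\ (0 < R2 /\ 0 < R3),
    (forall x x', X x -> X x' ->
       ((R1^-1)%:E * dX x x' - R2%:E <= dY (f x) (f x'))%E),
    (forall x x', X x -> X x' ->
       (dY (f x) (f x') <= R1%:E * dX x x' + R2%:E)%E) &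
    (forall y, Y y -> exists2 x, X x & (dY (f x) y <= R3%:E)%E)].

Definition product_dist (R : realType) (d : nat) (W : set 'M[R]_d)
    (dC : 'cV[R]_d -> 'cV[R]_d -> R) (x y : 'M[R]_d * 'cV[R]_d) : \bar R :=
  (word_dist W x.1 y.1 + (dC x.2 y.2)%:E)%E.

Definition orbit_map (R : realType) (d : nat) (x : 'M[R]_d * 'cV[R]_d) :
  'cV[R]_d := dual_act x.1 x.2.

(* Main.v *)
(* Write g.x for g^{-T} x, so that O = H.C and the translates of the cover are
   h_i.Q.  By (a3) the elements moving a compact L of O so that it meets itself
   form a compact set.
   - Upper bound.  Some connected K contained in a compact part of O contains C
     and all w.C with w in W.  By compactness and uniform discreteness, g.K meets
     at most N sets h_i.Q, with N independent of g; as g.K is connected, its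
     points are joined by chains of length at most N.  Thus moving from h to hw
     costs at most N in the chain distance.
   - Lower bound.  Consecutive sets of a chain satisfy
     h_i^{-1} h_j in T = {a : a.cl(Q) meets cl(Q)}, a compact subset of H_0, which
     is contained in finitely many powers of the open generating set W. *)
Require Import Defs.
From mathcomp Require Import all_boot all_order all_algebra finmap lra.
From mathcomp Require Import all_classical all_reals all_analysis.
Set Implicit Arguments.
Unset Strict Implicit.
Unset Printing Implicit Defensive.
Import Order.TTheory GRing.Theory Num.Theory.
Import numFieldNormedType.Exports.
Local Open Scope classical_set_scope.
Local Open Scope ring_scope.

(** * Continuity of matrix operations and compactness of sets of column vectors *)

Lemma cvg_mx (R : realType) (T : Type) (F : set_system T) m n
    (f : T -> 'M[R]_(m, n)) (A : 'M[R]_(m, n)) :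
  Filter F -> (forall i j, f t i j @[t --> F] --> A i j) ->
  f t @[t --> F] --> A.
Proof.
move=> FF fA B [P AP PB]; rewrite /nbhs/=.
have : \forall t \near F, forall i j, P i j (f t i j).
  apply: filter_forall => i; apply: filter_forall => j.
  exact: fA (AP i j).
by apply: filterS => t Pt; exact: PB.
Qed.

Lemma cvg_mulmx (R : realType) (T : Type) (F : set_system T) m n p
    (f : T -> 'M[R]_(m, n)) (g : T -> 'M[R]_(n, p))
    (A : 'M[R]_(m, n)) (B : 'M[R]_(n, p)) :
  Filter F -> f t @[t --> F] --> A -> g t @[t --> F] --> B ->
  f t *m g t @[t --> F] --> A *m B.
Proof.
move=> FF fA gB; apply: cvg_mx => i j; rewrite mxE.
under eq_cvg do rewrite mxE.
apply: cvg_big => [|k _]; first exact: add_continuous.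
apply: cvgM.
  exact: cvg_comp fA (@coord_continuous _ _ _ i k A).
exact: cvg_comp gB (@coord_continuous _ _ _ k j B).
Qed.

Lemma cvg_trmx (R : realType) (T : Type) (F : set_system T) m n
    (f : T -> 'M[R]_(m, n)) (A : 'M[R]_(m, n)) :
  Filter F -> f t @[t --> F] --> A -> (f t)^T @[t --> F] --> A^T.
Proof.
move=> FF fA; apply: cvg_mx => i j; rewrite mxE.
under eq_cvg do rewrite mxE.
exact: cvg_comp fA (@coord_continuous _ _ _ j i A).
Qed.

Lemma cvg_det (R : realType) (T : Type) (F : set_system T) n
    (f : T -> 'M[R]_n) (A : 'M[R]_n) :
  Filter F -> (forall i j, f t i j @[t --> F] --> A i j) ->
  \det (f t) @[t --> F] --> \det A.
Proof.
move=> FF fA; rewrite /determinant.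
apply: cvg_big => [|s _]; first exact: add_continuous.
apply: cvgM; first exact: cvg_cst.
apply: cvg_big => [|k _]; first exact: mul_continuous.
exact: fA.
Qed.

(** [invmx] is defined by cases; as [f t] is eventually a unit, it eventually agrees with the
    adjugate divided by the determinant, whose entries converge. *)
Lemma cvg_invmx (R : realType) (T : Type) (F : set_system T) n
    (f : T -> 'M[R]_n) (A : 'M[R]_n) :
  Filter F -> A \in unitmx -> (\forall t \near F, f t \in unitmx) ->
  f t @[t --> F] --> A -> invmx (f t) @[t --> F] --> invmx A.
Proof.
move=> FF uA uf fA.
have fAij i j : f t i j @[t --> F] --> A i j.
  exact: cvg_comp fA (@coord_continuous _ _ _ i j A).
apply: cvg_trans (_ : (\det (f t))^-1 *: \adj (f t) @[t --> F] --> invmx A).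
  apply: near_eq_cvg; apply: filterS uf => t uft.
  by rewrite /invmx uft.
rewrite /invmx uA; apply: cvg_mx => i j.
have scaleE (M : 'M[R]_n) :
    ((\det M)^-1 *: \adj M) i j = (\det M)^-1 * cofactor M j i.
  by rewrite mxE [in LHS]mxE.
rewrite scaleE; under eq_cvg do rewrite scaleE.
apply: cvgM.
  apply: cvgV; first by rewrite -unitfE -unitmxE.
  exact: cvg_det.
apply: cvgM; first exact: cvg_cst.
apply: cvg_det => k l; rewrite !mxE.
by under eq_cvg do rewrite !mxE; exact: fAij.
Qed.

(** Transposition is a norm-preserving homeomorphism, so the Heine-Borel property of row vectors
    carries over. *)
Lemma bounded_closed_compact_cV (R : realType) n (A : set 'cV[R]_n) :
  bounded_set A -> closed A -> compact A.
Proof.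
have ct m p : continuous (@trmx R m p).
  move=> M; exact: (@cvg_trmx _ _ (nbhs M) _ _ id M _ cvg_id).
move=> bA cA; have -> : A = trmx @` (trmx @^-1` A).
  apply/seteqP; split=> [x Ax|_ [y Ay <-]//].
  by exists x^T; rewrite /= ?trmxK.
apply: continuous_compact; first exact: (continuous_subspaceT (ct _ _)).
apply: bounded_closed_compact; last first.
  by apply: preimage_closed => // v _; exact: ct.
move: bA => [M [Mr MA]]; exists M; split=> // x Mx v Av /=.
suff -> : `|v| = `|v^T| by exact: MA.
rewrite /Num.norm /= !mx_normrE; apply/eqP; rewrite eq_le; apply/andP; split.
  apply/bigmax_leP; split=> [|[i j] _]; first exact: bigmax_ge_id.
  apply: le_trans (le_bigmax _ _ (j, i)); by rewrite mxE.
apply/bigmax_leP; split=> [|[i j] _]; first exact: bigmax_ge_id.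
by apply: le_trans (le_bigmax _ _ (j, i)); rewrite mxE.
Qed.

(** * Chains in finite open covers and connected hulls *)

(** In the intersection graph of the sets, let [a] be a vertex whose set contains [x]. The union [S]
    of the sets reachable from [a] and the union [S'] of the others are open and disjoint, so [S] is
    relatively clopen in [K] and contains it. *)
Lemma finite_cover_chain (T : topologicalType) (J : finType) (A : J -> set T)
    (K : set T) (x y : T) :
  (forall j, open (A j)) -> connected K -> K `<=` \bigcup_j A j ->
  K x -> K y -> exists2 m, (m <= #|J|)%N & is_chain A x y m.
Proof.
move=> oA cK KA Kx Ky.
have [a _ Aax] := KA _ Kx.
pose e : rel J := fun i j => `[< A i `&` A j !=set0 >].
pose S := \bigcup_(j in [set j | connect e a j]) A j.
pose S' := \bigcup_(j in [set j | ~ connect e a j]) A j.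
have oS : open S by apply: bigcup_open => j _; exact: oA.
have oS' : open S' by apply: bigcup_open => j _; exact: oA.
have SS' : K `&` S = K `&` ~` S'.
  apply/seteqP; split=> z [Kz].
    move=> [i ai Aiz]; split=> // -[j aj Ajz]; apply: aj => /=.
    by apply: connect_trans ai _; apply: connect1; apply/asboolP; exists z.
  move=> nS'z; split=> //; have [j _ Ajz] := KA _ Kz.
  have [aj|aj] := pselect (connect e a j); first by exists j.
  by exfalso; apply: nS'z; exists j.
have KS : K `&` S = K.
  apply: cK; first by exists x; split=> //; exists a => //=; exact: connect0.
    by exists S.
  by exists (~` S'); first exact: open_closedC.
have [_ [b /= /connectP[p ep bE] Aby]] : (K `&` S) y by rewrite KS.
rewrite {b}bE in Aby.
(* A path without repeated vertices visits at most [#|J|] sets, which bounds the length of the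
   chain. *)
case/shortenP: ep Aby => q eq uq _ Aqy.
exists (size (a :: q)); first by rewrite -(card_uniqP uq) max_card.
exists (nth a (a :: q)); split=> //; first by rewrite -last_nth.
move=> k /=; rewrite ltnS => kq.
by move/(pathP a)/(_ _ kq)/asboolP : eq.
Qed.

(** At the junction the last set of the first chain and the first set of the second share the point
    [y]. *)
Lemma is_chain_trans (T I : Type) (A : I -> set T) x y z m n :
  is_chain A x y m -> is_chain A y z n -> is_chain A x z (m + n).
Proof.
move=> [c [m0 cx cy cm]] [c' [n0 c'y c'z c'n]].
exists (fun k => if (k < m)%N then c k else c' (k - m)%N).
split; rewrite ?addn_gt0 ?m0 //.
- case: n n0 c'z c'n => // n _ /= c'z _.
  by rewrite addnS /= ltnNge leq_addr /= addKn.
- move=> k kmn; case: (ltngtP k.+1 m) => km.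
  + exact: cm.
  + move: km; rewrite ltnS => km; rewrite subSn //; apply: c'n.
    by rewrite -(ltn_add2l m) addnS subnKC.
  + move: cy; rewrite -km /= subnn => cy.
    by exists y.
Qed.

(** The union [S] of the open connected sets of [G] through [x] is relatively clopen in [X]: a
    neighbourhood from [G] of a point of [X] either misses [S] or can be glued to one of these
    sets. *)
Lemma connected_hull (T : topologicalType) (G : set (set T)) (X : set T) x :
  (forall K L, G K -> G L -> G (K `|` L)) ->
  (forall y, X y -> exists B, [/\ G B, open B, connected B & B y]) ->
  connected X -> X x ->
  forall y, X y -> exists K, [/\ G K, open K, connected K, K x & K y].
Proof.
move=> GU GX cX Xx.
pose S := \bigcup_(K in [set K | [/\ G K, open K, connected K & K x]]) K.
pose S' := \bigcup_(B in [set B | [/\ open B & B `&` S = set0]]) B.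
have oS : open S by apply: bigcup_open => j [].
have oS' : open S' by apply: bigcup_open => j [].
have SS' : X `&` S = X `&` ~` S'.
  apply/seteqP; split=> z [Xz].
    move=> Sz; split=> // -[B [_ BS] Bz].
    by have : (B `&` S) z by []; rewrite BS.
  move=> nS'z; split=> //; have [B [GB oB cB Bz]] := GX _ Xz.
  have [BS|/set0P[w [Bw [K [GK oK cK Kx] Kw]]]] := eqVneq (B `&` S) set0.
    by exfalso; apply: nS'z; exists B.
  exists (K `|` B); last by right.
  split; [exact: GU | exact: openU | | by left].
  by apply: connectedU => //; exists w.
have XS : X `&` S = X.
  apply: cX; last 2 first.
  - by exists S.
  - by exists (~` S'); first exact: open_closedC.
  - have [B [GB oB cB Bx]] := GX _ Xx.
    by exists x; split=> //; exists B.
move=> y; rewrite -{1}XS => -[_ [K [GK oK cK Kx] Ky]].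
by exists K.
Qed.

(** Each point of [E] shares an open connected hull with [x]. Finitely many hulls cover [E], and
    their union is connected because all contain [x]. *)
Lemma compact_connected_hull (T : ptopologicalType) (O X E : set T) x :
  (forall y, X y -> exists B L,
    [/\ open B, connected B, B y & [/\ compact L, L `<=` O & B `<=` L]]) ->
  connected X -> E `<=` X -> compact E -> E x ->
  exists K L,
    [/\ connected K, E `<=` K & [/\ compact L, L `<=` O & K `<=` L]].
Proof.
move=> hX cX EX cE Ex.
(* The sets with a compact envelope inside [O]; finite unions preserve this. *)
pose G := [set K : set T | exists L, [/\ compact L, L `<=` O & K `<=` L]].
have GU K L : G K -> G L -> G (K `|` L).
  move=> [K' [cK' K'O KK']] [L' [cL' L'O LL']]; exists (K' `|` L'); split.
  - exact: compactU.
  - by rewrite subUset.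
  - exact: setUSS.
have hull y : exists K, X y ->
    [/\ G K, open K, connected K, K x & K y].
  have [Xy|nXy] := pselect (X y); last by exists set0.
  have [|K hK] := connected_hull GU _ cX (EX _ Ex) Xy; last by exists K.
  by move=> z /hX[B [L [oB cB Bz hL]]]; exists B; split=> //; exists L.
have [K hK] := choice hull.
have {}cE : cover_compact E by rewrite -compact_cover.
have [y /EX/hK[]//|y Ey|D sD ED] := cE _ E K.
  by exists y => //; have /EX/hK[] := Ey.
have hD (y : T) :
    y \in D -> [/\ G (K y), open (K y), connected (K y), K y x & K y y].
  by move/sD; rewrite inE => /EX/hK.
(* Outside [D] the envelope is empty, so that compactness holds for every index of the finite
   union. *)
have hL (y : T) :
    exists L, compact L /\ (y \in D -> L `<=` O /\ K y `<=` L).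
  have [/hD[[L [? ? ?]] _ _ _ _]|_] := boolP (y \in D); first by exists L.
  by exists set0; split=> //; exact: compact0.
have [L {}hL] := choice hL.
exists (cover [set` D] K), (cover [set` D] L); split=> //.
  apply: bigcup_connected => [|i /= /hD[]//].
  by exists x => i /= /hD[].
split.
- rewrite /cover bigcup_fset; apply: bigsetU_compact => y _.
  exact: (hL y).1.
- by move=> z [i /= /(hL i).2[+ _]]; exact.
- by move=> z [i /= iD Kz]; exists i => //; exact: ((hL i).2 iD).2.
Qed.

(** * The right action [tact] and the left action [dual_act] *)

Lemma unitmx_mul_inv (R : realType) d (a b : 'M[R]_d) :
  a \in unitmx -> b \in unitmx -> invmx (a *m b) = invmx b *m invmx a.
Proof.
move=> ua ub; have uab : a *m b \in unitmx by rewrite unitmx_mul ua.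
apply: (can_inj (mulmxK uab)); rewrite mulVmx //.
by rewrite mulmxA mulmxKV // mulVmx.
Qed.

Lemma tact_mulmx (R : realType) d (a b : 'M[R]_d) x :
  tact (a *m b) x = tact b (tact a x).
Proof. by rewrite /tact trmx_mul mulmxA. Qed.

Lemma dual_act_mulmx (R : realType) d (a b : 'M[R]_d) x :
  a \in unitmx -> b \in unitmx ->
  dual_act (a *m b) x = dual_act a (dual_act b x).
Proof.
by move=> ua ub; rewrite /dual_act unitmx_mul_inv // trmx_mul mulmxA.
Qed.

Lemma tactK (R : realType) d (a : 'M[R]_d) :
  a \in unitmx -> cancel (tact a) (dual_act a).
Proof.
by move=> ua x; rewrite /dual_act /tact mulmxA -trmx_mul mulmxV // trmx1 mul1mx.
Qed.

Lemma dual_actK (R : realType) d (a : 'M[R]_d) :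
  a \in unitmx -> cancel (dual_act a) (tact a).
Proof.
by move=> ua x; rewrite /dual_act /tact mulmxA -trmx_mul mulVmx // trmx1 mul1mx.
Qed.

Lemma translate_preimage (R : realType) d (a : 'M[R]_d) (Q : set 'cV[R]_d) :
  a \in unitmx -> dual_act a @` Q = tact a @^-1` Q.
Proof.
move=> ua; apply/seteqP; split=> [_ [x Qx <-]|x Qx] /=.
  by rewrite dual_actK.
by exists (tact a x) => //; rewrite tactK.
Qed.

Lemma continuous_tact2 (R : realType) d :
  continuous (fun z : 'M[R]_d * 'cV[R]_d => tact z.1 z.2).
Proof.
move=> z; apply: cvg_mulmx; last exact: cvg_snd.
by apply: cvg_trmx; exact: cvg_fst.
Qed.

Lemma continuous_tact (R : realType) d (a : 'M[R]_d) : continuous (tact a).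
Proof.
move=> x; apply: (@cvg_mulmx _ _ (nbhs x) _ _ _ (fun=> a^T) id).
  exact: cvg_cst.
exact: cvg_id.
Qed.

Lemma open_translate (R : realType) d (a : 'M[R]_d) (Q : set 'cV[R]_d) :
  a \in unitmx -> open Q -> open (dual_act a @` Q).
Proof.
move=> ua oQ; rewrite translate_preimage //.
by apply: open_comp => // x _; exact: continuous_tact.
Qed.

Lemma connected_tact (R : realType) d (a : 'M[R]_d) (Q : set 'cV[R]_d) :
  connected Q -> connected (tact a @` Q).
Proof.
move=> cQ; apply: connected_continuous_connected => //.
exact: (continuous_subspaceT (@continuous_tact _ _ a)).
Qed.

Lemma compact_tact (R : realType) d (a : 'M[R]_d) (Q : set 'cV[R]_d) :
  compact Q -> compact (tact a @` Q).
Proof.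
move=> cQ; apply: continuous_compact => //.
exact: (continuous_subspaceT (@continuous_tact _ _ a)).
Qed.

Lemma tact_stable (R : realType) d (H : set 'M[R]_d) (C O : set 'cV[R]_d) a x :
  is_subgroup H -> O = tact_set H C -> H a -> O x -> O (tact a x).
Proof.
move=> [_ _ HM _] -> Ha [b Hb [c Cc <-]].
by exists (b *m a); [exact: HM | exists c => //; rewrite tact_mulmx].
Qed.

(** * Return sets and the stabilizer of a component *)

(** For units [a] this says that the image of [L] under [dual_act a] meets [L]; the form with [tact]
    matches the properness condition of integrable admissibility. *)
Definition return_set (R : realType) d (H : set 'M[R]_d) (L : set 'cV[R]_d) :=
  [set a | H a /\ exists2 xi, L xi & L (tact a xi)].

(** It is the projection to the group coordinate of the set that properness makes compact. *)
Lemma compact_return_set (R : realType) d (H : set 'M[R]_d)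
    (O L : set 'cV[R]_d) :
  integrably_admissible H O -> L `<=` O -> compact L ->
  compact (return_set H L).
Proof.
move=> [_ _ _ proper] LO cL.
have := @continuous_compact _ _ (@fst 'M[R]_d 'cV[R]_d) _ _ (proper _ LO cL).
have -> : fst @` [set z : 'M[R]_d * 'cV[R]_d |
    [/\ H z.1, O z.2, L (tact z.1 z.2) & L z.2]] = return_set H L.
  apply/seteqP; split=> [_ [[a x] [/= Ha Ox Lax Lx] <-]|a [Ha [x Lx Lax]]].
    by split=> //; exists x.
  by exists (a, x) => //; split=> //; exact: LO.
by apply; apply: continuous_subspaceT => z; exact: cvg_fst.
Qed.

Lemma translates_meet (R : realType) d (H : set 'M[R]_d) (L : set 'cV[R]_d)
    (u v : 'M[R]_d) :
  is_subgroup H -> H u -> H v ->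
  dual_act u @` L `&` dual_act v @` L !=set0 ->
  return_set H L (invmx u *m v).
Proof.
move=> [HGL _ HM HV] Hu Hv [z [[x Lx xz] [y Ly yz]]].
split; first by apply: HM => //; exact: HV.
(* [tact (invmx u)] and [dual_act u] are convertible. *)
exists x => //; rewrite tact_mulmx -[tact (invmx u) x]/(dual_act u x) xz -yz.
by rewrite dual_actK //; exact: HGL.
Qed.

(** The image of [O0] under [tact a] is a connected subset of [O] meeting [O0], hence lies in this
    component; the same argument for the inverse gives equality. *)
Lemma stabilizer_return (R : realType) d (H : set 'M[R]_d)
    (C O O0 : set 'cV[R]_d) a y :
  is_subgroup H -> O = tact_set H C -> component_containing O C O0 ->
  H a -> O0 y -> O0 (tact a y) -> stabilizer H O0 a.
Proof.
move=> sH OE [[x Ox O0E] _] Ha O0y O0ay; split=> //.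
have sub b z : H b -> O0 z -> O0 (tact b z) -> tact b @` O0 `<=` O0.
  move=> Hb O0z O0bz; rewrite [X in _ `<=` X]O0E.
  rewrite (same_connected_component (_ : connected_component O x (tact b z))).
    apply: connected_component_max.
    - by exists z.
    - move=> _ [w O0w <-]; apply: (tact_stable sH OE) => //.
      by move: O0w; rewrite O0E => /connected_component_sub.
    - by apply: connected_tact; rewrite O0E; exact: component_connected.
  by rewrite -O0E.
have [HGL _ _ HV] := sH; have ua : a \in unitmx by exact: HGL.
apply/seteqP; split; first exact: (sub _ y).
move=> z O0z; exists (dual_act a z); last by rewrite dual_actK.
apply: (sub (invmx a) (tact a y)); [exact: HV|by []| |by exists z].
by rewrite -[tact _ _]/(dual_act a _) tactK.
Qed.

Lemma stabilizer_subgroup (R : realType) d (H : set 'M[R]_d)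
    (O0 : set 'cV[R]_d) : is_subgroup H -> is_subgroup (stabilizer H O0).
Proof.
move=> [HGL H1 HM HV]; split.
- by move=> a [/HGL].
- split=> //; apply: eq_image_id => x _.
  by rewrite /tact trmx1 mul1mx.
- move=> a b [Ha aO] [Hb bO]; split; first exact: HM.
  rewrite -[RHS]bO -[in RHS]aO image_comp; apply: eq_imagel => x _.
  by rewrite tact_mulmx.
- move=> a [Ha aO]; split; first exact: HV.
  rewrite -[in LHS]aO image_comp; apply: eq_image_id => x _.
  by rewrite /= -[tact (invmx a) _]/(dual_act a _) tactK //; exact: HGL.
Qed.

(** * Powers of a generating set, and finiteness in well-spread families *)

Lemma set_pow_mul (R : realType) d (W : set 'M[R]_d) m n a b :
  set_pow W m a -> set_pow W n b -> set_pow W (m + n) (a *m b).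
Proof.
elim: m a => [|m IH] a /=; first by move=> -> ?; rewrite mul1mx.
move=> [w Ww [v Wv <-]] Wb; exists w => //; exists (v *m b); first exact: IH.
by rewrite mulmxA.
Qed.

Lemma set_powS (R : realType) d (W : set 'M[R]_d) n v w :
  W w -> set_pow W n v -> set_pow W n.+1 (w *m v).
Proof. by move=> Ww Wv; exists w => //; exists v. Qed.

(** Invertibility is carried through the induction because it is what allows the inverse of a
    product to be reversed. *)
Lemma set_pow_inv (R : realType) d (W : set 'M[R]_d) n a :
  W `<=` GL R d -> @invmx R d @` W = W ->
  set_pow W n a -> set_pow W n (invmx a) /\ a \in unitmx.
Proof.
move=> WGL Wsym; elim: n a => [a ->|n IH _ [w Ww [v /IH[Wv uv] <-]]].
  by rewrite invmx1 unitmx1.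
have uw : w \in unitmx by exact: WGL.
rewrite unitmx_mul uw uv; split=> //; rewrite unitmx_mul_inv // -addn1.
apply: set_pow_mul => //; rewrite -[invmx w]mulmx1; apply: set_powS => //.
by rewrite -Wsym; exists w.
Qed.

(** The union of the powers of [W] is a subgroup containing [W], closed under inverses by
    symmetry. *)
Lemma generates_set_pow (R : realType) d (H W : set 'M[R]_d) a :
  is_subgroup H -> generates H W -> @invmx R d @` W = W ->
  H a -> exists n, set_pow W n a.
Proof.
move=> [HGL _ _ _] [WH Wgen] Wsym; rewrite -{1}Wgen.
have WGL : W `<=` GL R d by move=> w /WH/HGL.
move=> /(_ [set a | exists n, set_pow W n a]); apply; split.
- split.
  + by move=> b [n /(set_pow_inv WGL Wsym)[]].
  + by exists 0%N.
  + by move=> b c [n Wb] [m Wc]; exists (n + m)%N; exact: set_pow_mul.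
  + by move=> b [n /(set_pow_inv WGL Wsym)[]]; exists n.
- by move=> w Ww; exists 1%N; rewrite -[w]mulmx1; exact: set_powS.
Qed.

(** Fix [w] in [W] and let [invmx w *m t] be a product of [n] letters. For [s] in [T] near [t], the
    element [s *m invmx t *m w] is still in the relatively open [W], so [s] is a product of [n.+1]
    letters; compactness makes the bound uniform. *)
Lemma compact_set_pow_bound (R : realType) d (H W T : set 'M[R]_d) :
  is_subgroup H -> generates H W -> @invmx R d @` W = W -> W !=set0 ->
  open_in H W -> compact T -> T `<=` H ->
  exists N, forall t, T t -> exists2 n, (n <= N)%N & set_pow W n t.
Proof.
move=> sH Wgen Wsym [w Ww] [V oV WE] cT TH.
have [HGL _ HM HV] := sH; have [WH _] := Wgen.
move/compact_near_coveringP/near_covering_withinP : cT => cT.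
have [|N _ hN] := cT nat \oo
    (fun N t => exists2 n, (n <= N)%N & set_pow W n t) _ _; last first.
  by exists N => t Tt; exact: (hN N (leqnn N)).
move=> t Tt; have Ht := TH _ Tt; have ut : t \in unitmx by exact: HGL.
have Hw := WH _ Ww; have uw : w \in unitmx by exact: HGL.
have [|n Wn] := @generates_set_pow _ _ H W (invmx w *m t) sH Wgen Wsym.
  by apply: HM => //; exact: HV.
have cont : s *m (invmx t *m w) @[s --> t] --> w.
  rewrite -{2}[w](mulKVmx ut).
  apply: (@cvg_mulmx _ _ (nbhs t) _ _ _ id (fun=> invmx t *m w)).
    exact: cvg_id.
  exact: cvg_cst.
have nV : nbhs w V.
  by apply: open_nbhs_nbhs; split=> //; move: Ww; rewrite WE => -[].
exists ([set s | V (s *m (invmx t *m w))], [set N | (n < N)%N]).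
  by split; [exact: cont | exists n.+1].
move=> [s N] /= [Vs nN] Ts; exists n.+1 => //.
have -> : s = (s *m (invmx t *m w)) *m (invmx w *m t).
  by rewrite -!mulmxA (mulmxA w) mulmxV // mul1mx mulVmx // mulmx1.
apply: set_powS => //; rewrite WE; split=> //.
by apply: (HM); [exact: TH|apply: HM => //; exact: HV].
Qed.

(* If t in H is close to s then s lies in t.U; hence a uniformly discrete
   subfamily has at most one member in g times a small neighbourhood of s. *)
Lemma well_spread_finite (R : realType) d (H : set 'M[R]_d) (I : Type)
    (h : I -> 'M[R]_d) (S : set 'M[R]_d) (i0 : I) :
  is_subgroup H -> well_spread H h -> compact S -> S `<=` H ->
  exists J : finType, forall g, H g ->
    exists f : J -> I, forall i, S (invmx g *m h i) -> exists j, f j = i.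
Proof.
move=> [HGL H1 HM HV] [Hh [n [P [PT ud]]] _] cS SH.
have hV k : exists V : set 'M[R]_d, open V /\ V 1%:M /\
    forall i j, P k i -> P k j -> i <> j ->
      (mulmx (h i) @` (H `&` V)) `&` (mulmx (h j) @` (H `&` V)) = set0.
  have [_ [[V oV ->] [_ V1] VP]] := ud k.
  by exists V.
have [V {}hV] := choice hV.
(* The guard [H t] is needed because inversion is continuous only on invertible matrices. *)
pose B s := [set t | H t -> forall k, V k (invmx t *m s)]°.
have BS s : S s -> nbhs s [set t | H t -> forall k, V k (invmx t *m s)].
  move=> Ss; have us : s \in unitmx by apply: HGL; exact: SH.
  have cont : invmx t *m s @[t --> within H (nbhs s)] --> (1%:M : 'M[R]_d).
    rewrite -(mulVmx us); apply: cvg_mulmx; last exact: cvg_cst.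
    apply: cvg_invmx => //; last exact: cvg_within.
    by apply: filterS (withinT _ _) => t /HGL.
  have : \forall t \near within H (nbhs s), forall k, V k (invmx t *m s).
    apply: filter_forall => k; apply: cont.
    by apply: open_nbhs_nbhs; have [oV [V1 _]] := hV k.
  by rewrite near_withinE.
have cS' : cover_compact S by rewrite -compact_cover.
have [s _|s Ss|D sDS SD] := cS' _ S B; first exact: open_interior.
  by exists s => //; exact: BS.
(* A label consists of a uniformly discrete subfamily and a centre of the finite cover of [S]; the
   labels do not depend on [g]. *)
exists ('I_n * D)%type => g Hg.
pose good (ka : 'I_n * D) i := [/\ P ka.1 i, S (invmx g *m h i) &
  forall k, V k (invmx (invmx g *m h i) *m val ka.2)].
(* Two indices with the same label [(k, s)] have translates of [H] intersected with [V k] that both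
   contain [g *m s], so they coincide. *)
have good_inj ka i j : good ka i -> good ka j -> i = j.
  case: ka => k [s sD] [/= Pi Si Vi] [/= Pj Sj Vj].
  have Hs : H s by apply: SH; have := sDS _ sD; rewrite inE.
  have translateE l : S (invmx g *m h l) ->
      V k (invmx (invmx g *m h l) *m s) ->
      (mulmx (h l) @` (H `&` V k)) (g *m s).
    move=> Sl Vl; have Hgl := SH _ Sl.
    exists (invmx (invmx g *m h l) *m s).
      by split=> //; apply: (HM) => //; exact: HV.
    have {1}-> : h l = g *m (invmx g *m h l) by rewrite mulKVmx //; exact: HGL.
    by rewrite -mulmxA mulKVmx //; exact: HGL.
  apply: contrapT => ij; have [_ [_ VP]] := hV k.
  suff : set0 (g *m s) by [].
  by rewrite -(VP i j Pi Pj ij); split; exact: translateE.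
(* Labels carried by no index receive the default [i0]. *)
have pick ka : exists i, forall j, good ka j -> i = j.
  have [[i gi]|none] := pselect (exists i, good ka i).
    by exists i => j; exact: good_inj.
  by exists i0 => j gj; exfalso; apply: none; exists j.
have [f fP] := choice pick; exists f => i Si.
have [k _ Pki] : (\bigcup_k P k) i by rewrite PT.
have [s /= sD Bsi] := SD _ Si.
exists (k, [` sD]%fset); apply: fP; split=> //= k'.
by move/interior_subset: Bsi; apply; exact: SH.
Qed.

(** * Distances as minimal lengths *)

(** By well-ordering the infimum is attained, so a finite infimum of lengths comes with a word or
    chain of exactly that length. *)
Lemma ereal_inf_nat (R : realType) (A : set nat) :
  (forall m, ~ A m) /\ ereal_inf [set (m%:R : R)%:E | m in A] = +oo%E \/
  exists2 m, A m & ereal_inf [set (m%:R : R)%:E | m in A] = m%:R%:E.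
Proof.
have [[m Am]|nA] := pselect (exists m, A m); last first.
  left; split=> [m Am|]; first by apply: nA; exists m.
  rewrite -[RHS]ereal_inf0; congr ereal_inf.
  by rewrite -subset0 => z [m Am _]; apply: nA; exists m.
right; have exA : exists m, `[< A m >] by exists m; exact/asboolP.
have [n /asboolP An nmin] := ex_minnP exA.
exists n => //; apply/eqP; rewrite eq_le; apply/andP; split.
  by apply: ereal_inf_lbound; exists n.
apply/ereal_infP => _ [k Ak <-].
by rewrite lee_fin ler_nat nmin //; exact/asboolP.
Qed.

Lemma word_distP (R : realType) d (W : set 'M[R]_d) x y :
  x \in unitmx ->
  word_dist W x y = +oo%E \/
  exists2 m, set_pow W m (invmx x *m y) & word_dist W x y = m%:R%:E.
Proof.
move=> ux; rewrite /word_dist; have [<-|_] := eqVneq x y.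
  by right; exists 0%N => //=; rewrite mulVmx.
by have [[_ ->]|] := ereal_inf_nat R [set m | set_pow W m (invmx x *m y)];
  [left|right].
Qed.

Lemma word_dist_le (R : realType) d (W : set 'M[R]_d) x y m :
  set_pow W m (invmx x *m y) -> (word_dist W x y <= m%:R%:E)%E.
Proof.
move=> Wm; rewrite /word_dist; case: eqVneq => _.
  by rewrite lee_fin ler0n.
by apply: ereal_inf_lbound; exists m.
Qed.

(** Chains have positive length, so the value 0 on the diagonal is a case of its own; for words it
    is realised by the empty product. *)
Lemma chain_distP (R : realType) (T : eqType) (I : Type) (A : I -> set T) x y :
  [\/ chain_dist R A x y = +oo%E, x = y /\ chain_dist R A x y = 0%E |
      exists2 m, is_chain A x y m & chain_dist R A x y = m%:R%:E].
Proof.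
rewrite /chain_dist; have [->|_] := eqVneq x y; first by apply: Or32.
by have [[_ ->]|] := ereal_inf_nat R [set m | is_chain A x y m];
  [apply: Or31|apply: Or33].
Qed.

Lemma chain_dist_le (R : realType) (T : eqType) (I : Type) (A : I -> set T)
    x y m :
  is_chain A x y m -> (chain_dist R A x y <= m%:R%:E)%E.
Proof.
move=> cm; rewrite /chain_dist; case: eqVneq => _.
  by rewrite lee_fin ler0n.
by apply: ereal_inf_lbound; exists m.
Qed.

(** * From words to chains and back *)

Lemma dual_act_stable (R : realType) d (H : set 'M[R]_d) (C O : set 'cV[R]_d)
    a x :
  is_subgroup H -> O = tact_set H C -> H a -> O x -> O (dual_act a x).
Proof.
move=> sH OE Ha Ox; have [_ _ _ HV] := sH.
exact: (tact_stable sH OE (HV _ Ha) Ox).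
Qed.

Lemma compact_closure_cV (R : realType) n (A : set 'cV[R]_n) :
  bounded_set A -> compact (closure A).
Proof.
move=> bA; apply: bounded_closed_compact_cV; last exact: closed_closure.
have [M [Mr MA]] := bA; exists M; split=> // x Mx v Av /=.
have cB : closed [set v : 'cV[R]_n | `|v| <= x].
  apply: (@preimage_closed _ _ (fun v : 'cV[R]_n => `|v|) [set y | y <= x]).
    by move=> w _; exact: norm_continuous.
  exact: closed_le.
by apply: cB; apply: closureS Av => w; exact: MA.
Qed.

(** Every point of [O] is some [tact a c] with [c] in [C]. The image of [Q] under [tact a] is an
    open connected neighbourhood of it, and the image of [closure Q] is a compact envelope inside
    [O]. *)
Lemma component_hull (R : realType) d (H : set 'M[R]_d)
    (C O O0 Q E : set 'cV[R]_d) x :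
  is_subgroup H -> O = tact_set H C -> component_containing O C O0 ->
  open Q -> bounded_set Q -> connected Q -> C `<=` Q -> closure Q `<=` O ->
  E `<=` O0 -> compact E -> E x ->
  exists K L,
    [/\ connected K, E `<=` K & [/\ compact L, L `<=` O & K `<=` L]].
Proof.
move=> sH OE [[x0 Ox0 O0E] _] oQ bQ cQ CQ QO EO0 cE Ex.
have [HGL _ _ HV] := sH.
apply: compact_connected_hull EO0 cE Ex; last first.
  by rewrite O0E; exact: component_connected.
move=> y; rewrite O0E => /connected_component_sub; rewrite OE.
move=> [a Ha [c Cc <-]]; have ua := HGL _ Ha.
exists (tact a @` Q), (tact a @` closure Q); split.
- have -> : tact a @` Q = dual_act (invmx a) @` Q by rewrite /dual_act invmxK.
  by apply: open_translate => //; rewrite unitmx_inv.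
- exact: connected_tact.
- by exists c => //; exact: CQ.
- split; last by apply: image_subset; exact: subset_closure.
    by apply: compact_tact; exact: compact_closure_cV.
  by move=> _ [z Qz <-]; rewrite -OE; apply: (tact_stable sH OE) => //;
    exact: QO.
Qed.

(** The case of [w] equal to the identity serves to change the point of [C] at a fixed group
    element. *)
Lemma chain_step (R : realType) d (H : set 'M[R]_d) (C O O0 Q : set 'cV[R]_d)
    (W : set 'M[R]_d) (I : Type) (h : I -> 'M[R]_d) :
  integrably_admissible H O -> O = tact_set H C ->
  component_containing O C O0 -> compact C ->
  relatively_compact_in (stabilizer H O0) W -> @invmx R d @` W = W ->
  open Q -> bounded_set Q -> connected Q -> C `<=` Q -> closure Q `<=` O ->
  well_spread H h -> O = \bigcup_i translates h Q i ->
  exists N, forall g w xi eta, H g -> w = 1%:M \/ W w -> C xi -> C eta ->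
    exists2 m, (m <= N)%N &
      is_chain (translates h Q) (dual_act g xi) (dual_act (g *m w) eta) m.
Proof.
move=> iaH OE compO cC [WH0 cW] Wsym oQ bQ cQ CQ QO hspread OQ.
have [[sH _] _ _ _] := iaH; have [HGL H1 HM HV] := sH.
have [Hh _ _] := hspread.
have [[c Cc]|noC] := pselect (C !=set0); last first.
  by exists 0%N => g w xi eta _ _ Cxi; exfalso; apply: noC; exists xi.
have CO0 : C `<=` O0 by case: compO.
have O0O : O0 `<=` O.
  by have [[x _ ->] _] := compO; exact: connected_component_sub.
have [i0 _ _] : (\bigcup_i translates h Q i) c.
  by rewrite -OQ; apply: O0O; exact: CO0.
(* As [W] is symmetric, [dual_act w eta] equals [tact (invmx w) eta] with [invmx w] in [W], so it
   lies in [E]. Taking the closure of [W] makes [E] compact. *)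
pose E := C `|` (fun z : 'M[R]_d * 'cV[R]_d => tact z.1 z.2) @`
  ((stabilizer H O0 `&` closure W) `*` C).
have cE : compact E.
  apply: compactU => //; apply: continuous_compact; last exact: compact_setX.
  exact: (continuous_subspaceT (@continuous_tact2 R d)).
have EO0 : E `<=` O0.
  move=> _ [/CO0//|[[a x] /= [[[_ aO0] _] Cx] <-]].
  by rewrite -aO0; exists x => //; exact: CO0.
have [K [L [cK EK [cL LO KL]]]] := @component_hull R d H C O O0 Q E c
  sH OE compO oQ bQ cQ CQ QO EO0 cE (or_introl Cc).
(* One compact set contains both [K] and [Q]: if the translate of [K] by [g] meets that of [Q] by
   [h i], then [invmx g *m h i] is in [return_set H L']. *)
pose L' := L `|` closure Q.
have cS : compact (return_set H L').
  apply: (compact_return_set iaH); first by rewrite subUset.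
  by apply: compactU => //; exact: compact_closure_cV.
have [|J hJ] := well_spread_finite i0 sH hspread cS; first by move=> a [].
exists #|J| => g w xi eta Hg Ww Cxi Ceta.
have [f fP] := hJ g Hg.
have Hw : H w by case: Ww => [->//|/WH0[]].
have Kxi : K xi by apply: EK; left.
have Keta : K (dual_act w eta).
  apply: EK; case: Ww => [->|Ww].
    by left; rewrite /dual_act invmx1 trmx1 mul1mx.
  right; exists (invmx w, eta) => //; split=> //=.
  have Wiw : W (invmx w) by rewrite -Wsym; exists w.
  by split; [exact: WH0 | exact: subset_closure].
have [|||||m mJ [k [m0 kx ky km]]] :=
  @finite_cover_chain _ J (translates h Q \o f) (dual_act g @` K)
    (dual_act g xi) (dual_act (g *m w) eta).
- by move=> j; apply: open_translate => //; exact/HGL/Hh.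
- exact: connected_tact.
- move=> _ [z Kz <-]; have Ogz : O (dual_act g z).
    by apply: (dual_act_stable sH OE) => //; apply: LO; exact: KL.
  have [i _ Qi] : (\bigcup_i translates h Q i) (dual_act g z) by rewrite -OQ.
  have [j fj] : exists j, f j = i.
    apply: fP; apply: translates_meet => //; exists (dual_act g z); split.
      by exists z => //; left; exact: KL.
    by have [q Qq <-] := Qi; exists q => //; right; exact: subset_closure.
  by exists j => //=; rewrite fj.
- by exists xi.
- by exists (dual_act w eta) => //; rewrite dual_act_mulmx //; exact: HGL.
- by exists m => //; exists (f \o k); split.
Qed.

(** Each of the [n] letters costs one step with [xi] kept fixed; one last step passes from [xi] to
    [eta]. *)
Lemma chain_set_pow (R : realType) d (H : set 'M[R]_d) (C Q : set 'cV[R]_d)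
    (W : set 'M[R]_d) (I : Type) (h : I -> 'M[R]_d) N n g v xi eta :
  is_subgroup H -> W `<=` H ->
  (forall g w xi eta, H g -> w = 1%:M \/ W w -> C xi -> C eta ->
    exists2 m, (m <= N)%N &
      is_chain (translates h Q) (dual_act g xi) (dual_act (g *m w) eta) m) ->
  H g -> set_pow W n v -> C xi -> C eta ->
  exists2 m, (m <= N * n.+1)%N &
    is_chain (translates h Q) (dual_act g xi) (dual_act (g *m v) eta) m.
Proof.
move=> [_ _ HM _] WH step; elim: n g v xi => [|n IH] g v xi Hg.
  by move=> -> Cxi Ceta; rewrite muln1; apply: step => //; left.
move=> [w Ww [u Wu <-]] Cxi Ceta.
have [m mN cm] := step g w xi xi Hg (or_intror Ww) Cxi Cxi.
have [m' mN' cm'] := IH (g *m w) u xi (HM _ _ Hg (WH _ Ww)) Wu Cxi Ceta.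
exists (m + m')%N; first by rewrite mulnS leq_add.
by rewrite mulmxA; exact: is_chain_trans cm cm'.
Qed.

(** There are [m.+1] transitions: from [g] to the first set, [m.-1] inside the chain, and from the
    last set to [g']. Each is an element of [return_set H Q], worth at most [N] letters. *)
Lemma set_pow_chain (R : realType) d (H : set 'M[R]_d) (Q : set 'cV[R]_d)
    (W : set 'M[R]_d) (I : Type) (h : I -> 'M[R]_d) N m g g' x y :
  is_subgroup H -> (forall i, H (h i)) ->
  (forall t, return_set H Q t -> exists2 n, (n <= N)%N & set_pow W n t) ->
  H g -> H g' -> (dual_act g @` Q) x -> (dual_act g' @` Q) y ->
  is_chain (translates h Q) x y m ->
  exists2 n, (n <= N * m.+1)%N & set_pow W n (invmx g *m g').
Proof.
move=> sH Hh bound Hg Hg' gx gy [c [m0 cx cy cm]].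
have [HGL _ _ _] := sH.
have step u v z : H u -> H v -> (dual_act u @` Q) z -> (dual_act v @` Q) z ->
    exists2 n, (n <= N)%N & set_pow W n (invmx u *m v).
  by move=> Hu Hv uz vz; apply: bound; apply: translates_meet => //; exists z.
have trans u v w k l : H v ->
    (exists2 n, (n <= N * k)%N & set_pow W n (invmx u *m v)) ->
    (exists2 n, (n <= N * l)%N & set_pow W n (invmx v *m w)) ->
    exists2 n, (n <= N * (k + l))%N & set_pow W n (invmx u *m w).
  move=> Hv [n nk Wn] [n' nl Wn']; exists (n + n')%N.
    by rewrite mulnDr leq_add.
  have -> : invmx u *m w = (invmx u *m v) *m (invmx v *m w).
    by rewrite -mulmxA mulKVmx //; exact: HGL.
  exact: set_pow_mul.
have chain k : (k < m)%N ->
    exists2 n, (n <= N * k.+1)%N & set_pow W n (invmx g *m h (c k)).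
  elim: k => [_|k IH km]; first by rewrite muln1; exact: step gx cx.
  rewrite -addn1; apply: (trans _ (h (c k))) => //; first exact/IH/ltnW.
  rewrite muln1; have [z [kz kz']] := cm _ km.
  exact: step kz kz'.
rewrite -addn1; apply: (trans _ (h (c m.-1))) => //.
  by have := chain m.-1; rewrite prednK //; apply.
by rewrite muln1; exact: step cy gy.
Qed.

(** * Combination of the two estimates *)

Theorem theorem3p16 (R : realType) (d : nat) (H : set 'M[R]_d)
    (O : set 'cV[R]_d) (hH : connectivity_respecting H O)
    (C : set 'cV[R]_d) (hCO : C `<=` O) (hCcompact : compact C)
    (hCconn : connected C) (hHC : O = tact_set H C)
    (O0 : set 'cV[R]_d) (hO0 : component_containing O C O0)
    (W : set 'M[R]_d) (hW0 : W !=set0)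
    (hWopen : open_in (stabilizer H O0) W)
    (hWprecompact : relatively_compact_in (stabilizer H O0) W)
    (hWsym : @invmx R d @` W = W)
    (hWgen : generates (stabilizer H O0) W)
    (I : Type) (h : I -> 'M[R]_d) (hspread : well_spread H h)
    (Q : set 'cV[R]_d) (hQopen : open Q) (hQbounded : bounded_set Q)
    (hQconn : connected Q) (hCQ : C `<=` Q) (hQO : closure Q `<=` O)
    (hcover : induced_cover O h Q)
    (dC : 'cV[R]_d -> 'cV[R]_d -> R) (hdC : is_bounded_metric C dC) :
  set_surj (H `*` C) O (@orbit_map R d) /\
  quasi_isometry (H `*` C) (product_dist W dC)
    O (chain_dist R (translates h Q)) (@orbit_map R d).
Proof.
have [iaH _] := hH; have [[sH _] _ _ _] := iaH.
have [HGL H1 HM HV] := sH; have [Hh _ _] := hspread.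
have [P [_ _ OQ _ _]] := hcover.
have [WH0 _] := hWprecompact.
have sH0 := stabilizer_subgroup O0 sH.
have H0H : stabilizer H O0 `<=` H by move=> a [].
have WH : W `<=` H by move=> w /WH0/H0H.
have surj y : O y -> exists2 z, (H `*` C) z & orbit_map z = y.
  rewrite {1}hHC => -[a Ha [c Cc <-]].
  exists (invmx a, c); first by split=> //; exact: HV.
  by rewrite /orbit_map /dual_act /= invmxK.
have into : set_fun (H `*` C) O (@orbit_map R d).
  by move=> [a c] [/= Ha Cc]; exact: (dual_act_stable sH hHC Ha (hCO _ Cc)).
split; first by move=> y /surj[z ? <-]; exists z.
split=> //.
(* [closure Q] is a connected subset of [O] that meets [O0] in a point of [C], which is nonempty
   because [O] is. *)
have QbarO0 : closure Q `<=` O0.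
  have [[x Ox O0E] CO0] := hO0.
  have [c Cc] : C !=set0 by move: Ox; rewrite hHC => -[_ _ [c Cc _]]; exists c.
  rewrite O0E (same_connected_component (_ : connected_component O x c)).
    apply: connected_component_max => //.
      by apply: subset_closure; exact: hCQ.
    exact: connected_closure.
  by rewrite -O0E; exact: CO0.
have QQbar : Q `<=` closure Q by exact: subset_closure.
have [N2 bound] : exists N, forall t, return_set H Q t ->
    exists2 n, (n <= N)%N & set_pow W n t.
  have := @compact_set_pow_bound _ _ _ _ (return_set H (closure Q))
    sH0 hWgen hWsym hW0 hWopen _ _.
  case=> [||N hN].
    exact: compact_return_set iaH hQO (compact_closure_cV hQbounded).
    move=> a [Ha [y Qy Qay]].
    by apply: (stabilizer_return sH hHC hO0 Ha (QbarO0 _ Qy)); exact: QbarO0.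
  exists N => t [Ht [y Qy Qty]].
  by apply: hN; split=> //; exists y; exact: QQbar.
have [N1 step] := chain_step iaH hHC hO0 hCcompact hWprecompact hWsym hQopen
  hQbounded hQconn hCQ hQO hspread OQ.
have [dC_ge0 _ _ [M dC_le]] := hdC.
pose n1 : R := N1%:R; pose n2 : R := N2%:R.
have n1_ge0 : 0 <= n1 by exact: ler0n.
have n2_ge0 : 0 <= n2 by exact: ler0n.
have M_ge0 : 0 <= `|M| by [].
(* Words have length at most [n2 * (m + 1)] and chains at most [n1 * (n + 1)]; [M] bounds [dC]. The
   added 1 keeps the constants positive if [N1] and [N2] vanish, and by surjectivity any positive
   third constant works. *)
exists (n1 + n2 + 1), (n1 + n2 + `|M| + 1), 1; split.
- by split; [lra|split; lra].
- move=> [g xi] [g' xi'] [/= Hg Cxi] [/= Hg' Cxi']; rewrite /orbit_map /=.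
  (* Here [m] stands for the chain distance: the length of a shortest chain, or 0 when the two image
     points coincide. *)
  have lower m :
      (exists2 n, (n <= N2 * m.+1)%N & set_pow W n (invmx g *m g')) ->
      (((n1 + n2 + 1)^-1)%:E * product_dist W dC (g, xi) (g', xi') -
        (n1 + n2 + `|M| + 1)%:E <= m%:R%:E)%E.
    move=> [n nm Wn]; have [Winf|[k _ Wk]] := word_distP W g' (HGL _ Hg).
      by have := word_dist_le Wn; rewrite Winf leye_eq.
    have := word_dist_le Wn; rewrite Wk lee_fin ler_nat => kn.
    rewrite /product_dist /= Wk -[(_ + _)%E in X in (_ * X)%E]EFinD -EFinM.
    rewrite -EFinB lee_fin.
    rewrite lerBlDr mulrC ler_pdivrMr; last by lra.
    have : k%:R <= n2 * (m%:R + 1) :> R.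
      by rewrite natr1 -natrM ler_nat (leq_trans kn).
    have := dC_le _ _ Cxi Cxi'; have := ler_norm M; have : 0 <= m%:R :> R by [].
    nra.
  have [->|[xy ->]|[m cm ->]] :=
    chain_distP R (translates h Q) (dual_act g xi) (dual_act g' xi').
  + by rewrite leey.
  (* For equal image points the translates of [Q] by [g] and [g'] meet, so one element of
     [return_set H Q] suffices. *)
  + apply: (lower 0%N); rewrite muln1; apply: bound.
    apply: translates_meet => //.
    exists (dual_act g xi); split; first by exists xi => //; exact: hCQ.
    by rewrite xy; exists xi' => //; exact: hCQ.
  + apply: lower; apply: (set_pow_chain sH Hh bound Hg Hg' _ _ cm).
      by exists xi => //; exact: hCQ.
    by exists xi' => //; exact: hCQ.
- move=> [g xi] [g' xi'] [/= Hg Cxi] [/= Hg' Cxi']; rewrite /orbit_map /=.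
  have [dC0 _] := dC_ge0 _ _ Cxi Cxi'.
  rewrite /product_dist /=; have [->|[n Wn ->]] := word_distP W g' (HGL _ Hg).
    (* If the word distance is infinite, the right-hand side is infinite because the factor is
       positive. *)
    by rewrite addye // gt0_muley ?lte_fin ?addye ?leey //; lra.
  have [m mN] := chain_set_pow sH WH step Hg Wn Cxi Cxi'.
  rewrite mulKVmx; last exact: HGL.
  move=> /(chain_dist_le R)/le_trans; apply.
  rewrite -[(_ + _)%E in X in (_ * X)%E]EFinD -EFinM -EFinD lee_fin.
  have : m%:R <= n1 * (n%:R + 1) :> R by rewrite natr1 -natrM ler_nat.
  have : 0 <= n%:R :> R by [].
  nra.
- move=> y /surj[z HCz <-]; exists z => //.
  by rewrite /chain_dist eqxx lee_fin.
Qed.
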